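(* Let $l>0$, $\gamma\in(0,1)$ and let $\epsilon:[0,\infty)\to(0,\infty)$ be a monotonically decreasing measurable function such that $\int_1^\infty\frac{\epsilon(k)}{k}\,\mathrm{d}k<\infty$ and $\liminf_{k\to\infty}k^\gamma\epsilon(k)>0$. Then there is a non-negative even real-valued $g\in C_0^\infty(\mathbb{R})$ with support in $[-l,l]$ such that $\int g=1$ and $$\hat g(k)\ge e^{-|k|\epsilon(|k|)}\qquad\text{for all }k\in\mathbb{R}.$$
   Context: The Fourier transform is $\hat f(k)=\int_{\mathbb{R}} e^{-ikx}f(x)\,\mathrm{d}x$. *)

(* Defs.v *)
From HB Require Import structures.
From mathcomp Require Import all_boot all_order all_algebra.
From mathcomp Require Import all_classical all_reals all_analysis.
Set Implicit Arguments. Unset Strict Implicit. Unset Printing Implicit Defensive.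
Import Order.TTheory GRing.Theory Num.Theory.
Import numFieldNormedType.Exports.
Local Open Scope classical_set_scope.
Local Open Scope ring_scope.

(* Fourier transform \hat f(k) = \int_R e^{-ikx} f(x) dx of a real-valued f,
   given by its real and imaginary parts:
   Re \hat f(k) = \int cos(kx) f(x) dx,  Im \hat f(k) = - \int sin(kx) f(x) dx. *)
Definition fourier_re (R : realType) (f : R -> R) (k : R) : R :=
  Rintegral (@lebesgue_measure R) setT (fun x => cos (k * x) * f x).
Definition fourier_im (R : realType) (f : R -> R) (k : R) : R :=
  - Rintegral (@lebesgue_measure R) setT (fun x => sin (k * x) * f x).

Definition smooth (R : realType) (f : R -> R) : Prop :=
  forall (n : nat) (x : R), derivable (derive1n n f) x 1.

(* Main.v *)
(* The hypotheses give eps k >= c (1 + k)^(-gamma) with c > 0, so with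
   beta = 1 - gamma in (0, 1) it is enough to bound the transform of g from below
   by exp (- c' |k|^beta) for large |k| and to control it near k = 0.

   A function with a transform that decays this slowly is a smooth bump psi with
   nonnegative transform (the autocorrelation of a bump, with transform
   |eta^|^2), modulated by a positive density of frequencies:
     G x = psi x * int w(s) (1 + cos (s x / a)) ds,
     w(s) = exp (- (1 + s^2)^(beta / 2)).
   The weight w decays faster than any power, so G is smooth, and
     G^ k = int w(s) (psi^ k + (psi^ (k + s/a) + psi^ (k - s/a)) / 2) ds
   has a nonnegative integrand.  If psi lives on [-a, a], then
   psi^ q >= psi^ 0 / 2 for |q| <= 1/a, and the frequencies s with
   |k - s/a| <= 1/a alone yield G^ k >= A w(a |k| + 1) G^ 0, where A does not
   depend on a.

   For |k| >= 1/a the bound is of size exp (- C (a |k|)^beta), which beats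
   exp (- |k| eps |k|) once a is small.  For |k| <= 1/a the elementary bound
   G^ k / G^ 0 >= 1 - (a k)^2 / 2 is enough, again for small a. *)

Require Import Defs.
From HB Require Import structures.
From mathcomp Require Import all_boot all_order all_algebra.
From mathcomp Require Import all_classical all_reals all_analysis.
From mathcomp Require Import measurable_realfun.
From mathcomp Require Import ring lra.
Import Order.TTheory GRing.Theory Num.Theory.
Import numFieldNormedType.Exports.
Local Open Scope classical_set_scope.
Local Open Scope ring_scope.

Set Implicit Arguments.
Unset Strict Implicit.

(** * Smooth functions *)

Lemma smoothP (R : realType) (f : R -> R) :
  smooth f <-> (forall x, derivable f x 1) /\ smooth (derive1 f).
Proof.
split=> [sf|[df sf] [|n] x].
- split=> [x|n x]; first exact: (sf 0%N).
  by have := sf n.+1 x; rewrite /derive1n iterSr.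
- exact: df.
- by rewrite /derive1n iterSr; exact: sf.
Qed.

Lemma smooth_derivable (R : realType) (f : R -> R) :
  smooth f -> forall x, derivable f x 1.
Proof. by case/smoothP. Qed.

Lemma smooth_derive1 (R : realType) (f : R -> R) : smooth f -> smooth (derive1 f).
Proof. by case/smoothP. Qed.

Lemma smooth_derive1n (R : realType) (f : R -> R) n :
  smooth f -> smooth (derive1n n f).
Proof. by move=> sf; elim: n => [|n]; [exact: sf|exact: smooth_derive1]. Qed.

Lemma derivable1_continuous (R : realType) (f : R -> R) :
  (forall x, derivable f x 1) -> continuous f.
Proof. by move=> df x; exact/differentiable_continuous/derivable1_diffP. Qed.

Lemma smooth_continuous (R : realType) (f : R -> R) : smooth f -> continuous f.
Proof. by move=> sf; apply: derivable1_continuous; exact: smooth_derivable. Qed.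

(** Finite-order form of [smooth]. Closure under sums, products and affine substitutions is an
    induction on the order: the derivative of such an expression is built from the same operations,
    with one order less at hand. *)
Definition nderivable (R : realType) (n : nat) (f : R -> R) : Prop :=
  forall k x, (k < n)%N -> derivable (derive1n k f) x 1.

Lemma smooth_nderivable (R : realType) (f : R -> R) :
  smooth f <-> forall n, nderivable n f.
Proof.
split=> [sf n k x _|sf n x]; first exact: sf.
exact: (sf n.+1 n x (ltnSn n)).
Qed.

Lemma nderivable0 (R : realType) (f : R -> R) : nderivable 0 f.
Proof. by []. Qed.

Lemma nderivableS (R : realType) n (f df : R -> R) :
  (forall x : R, is_derive x 1 f (df x)) -> nderivable n df ->
  nderivable n.+1 f.
Proof.
move=> fdf sf.
have dfE : (derive1 f) = df by apply/funext => x; rewrite derive1E derive_val.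
move=> [|k] x kn; first by have [] := fdf x.
by rewrite /derive1n iterSr dfE; exact: sf.
Qed.

Lemma nderivableSP (R : realType) n (f : R -> R) : nderivable n.+1 f ->
  (forall x : R, is_derive x 1 f ((derive1 f) x)) /\ nderivable n (derive1 f).
Proof.
move=> sf; split=> [x|k x kn].
  by rewrite derive1E; apply: derivableP; exact: (sf 0%N).
by have := sf k.+1 x kn; rewrite /derive1n iterSr.
Qed.

Lemma nderivableW (R : realType) n (f : R -> R) :
  nderivable n.+1 f -> nderivable n f.
Proof. by move=> sf k x kn; apply: sf; exact: ltnW. Qed.

Lemma is_derive_add (R : realType) (f g : R -> R) (x df dg : R) :
  is_derive x 1 f df -> is_derive x 1 g dg ->
  is_derive x 1 (fun x => f x + g x) (df + dg).
Proof. by move=> hf hg; exact: (is_deriveD hf hg). Qed.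

Lemma is_derive_mul (R : realType) (f g : R -> R) (x df dg : R) :
  is_derive x 1 f df -> is_derive x 1 g dg ->
  is_derive x 1 (fun x => f x * g x) (f x * dg + g x * df).
Proof. by move=> hf hg; exact: (is_deriveM hf hg). Qed.

Lemma nderivableD (R : realType) n (f g : R -> R) :
  nderivable n f -> nderivable n g ->
  nderivable n (fun x => f x + g x).
Proof.
elim: n f g => [|n IH] f g; first exact (fun _ _ => @nderivable0 R _).
move=> /nderivableSP[df sf] /nderivableSP[dg sg].
exact (nderivableS (fun x => is_derive_add (df x) (dg x)) (IH _ _ sf sg)).
Qed.

Lemma nderivableM (R : realType) n (f g : R -> R) :
  nderivable n f -> nderivable n g ->
  nderivable n (fun x => f x * g x).
Proof.
elim: n f g => [|n IH] f g sf0 sg0; first exact (@nderivable0 R _).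
have [[df sf] [dg sg]] := (nderivableSP sf0, nderivableSP sg0).
exact (nderivableS (fun x => is_derive_mul (df x) (dg x))
  (nderivableD (IH _ _ (nderivableW sf0) sg)
                 (IH _ _ (nderivableW sg0) sf))).
Qed.

Lemma smoothM (R : realType) (f g : R -> R) :
  smooth f -> smooth g -> smooth (fun x => f x * g x).
Proof.
move=> /smooth_nderivable sf /smooth_nderivable sg.
apply/smooth_nderivable => n; exact (nderivableM (sf n) (sg n)).
Qed.

Lemma smooth_cst (R : realType) (c : R) : smooth (fun=> c).
Proof.
have E n : derive1n n.+1 (fun=> c : R) = (fun=> 0).
  elim: n => [|n IH]; first by apply/funext => x; rewrite /= derive1_cst.
  by rewrite derive1nS IH; apply/funext => x; rewrite derive1_cst.
by move=> [|n] x; rewrite ?E; exact: derivable_cst.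
Qed.

Lemma is_derive_affine (R : realType) (f : R -> R) (u c x df : R) :
  is_derive (u + c * x) 1 f df ->
  is_derive x 1 (fun x => f (u + c * x)) (c * df).
Proof.
move=> fdf; rewrite mulrC.
apply: (@is_derive1_comp _ f (fun x => u + c * x)).
have := is_deriveD (is_derive_cst u x (1 : R)) (is_deriveZ c (is_derive_id x (1 : R))).
by rewrite add0r scaler1.
Qed.

Lemma smooth_affine (R : realType) (f : R -> R) (u c : R) :
  smooth f -> smooth (fun x => f (u + c * x)).
Proof.
move=> /smooth_nderivable sf; apply/smooth_nderivable => n.
move: (sf n); elim: n f {sf} => [|n IH] f; first exact (fun _ => @nderivable0 R _).
move=> /nderivableSP[df sf].
have sc : nderivable n (fun _ : R => c).
  exact ((smooth_nderivable _).1 (@smooth_cst R c) n).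
exact (nderivableS (fun x => is_derive_affine (df (u + c * x)))
  (nderivableM sc (IH _ sf))).
Qed.

(** * Differentiation under the integral sign *)

(** Dominated differentiation: [G0] makes every [f x] integrable and [G] dominates the derivative.
    Both bounds are global in [x], so any window around the point serves; the proof takes radius
    1. *)
Lemma is_derive_integral (R : realType) d (Y : measurableType d)
    (mu : {measure set Y -> \bar R}) (f df : R -> Y -> R) (G0 G : Y -> R) :
  (forall (x : R) y, is_derive x 1 (f ^~ y) (df x y)) ->
  (forall x, measurable_fun setT (f x)) ->
  mu.-integrable setT (EFin \o G0) -> mu.-integrable setT (EFin \o G) ->
  (forall x y, `|f x y| <= G0 y) -> (forall x y, `|df x y| <= G y) ->
  forall x : R, is_derive x 1 (fun x => Rintegral mu setT (f x))
                          (Rintegral mu setT (df x)).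
Proof.
move=> fdf mf iG0 iG fG0 dfG x.
have xI : `]x - 1, x + 1[%classic x.
  by rewrite /= in_itv/=; apply/andP; split; lra.
have intf z : mu.-integrable setT (EFin \o f z).
  apply: (le_integrable measurableT _ _ iG0).
    exact/measurable_EFinP.
  by move=> y _; rewrite /= lee_fin (le_trans (fG0 z y))// ler_norm.
have d1E z y : partial1of2 f z y = df z y.
  by rewrite partial1of2E; have [_ ->] := fdf z y.
have G_ge0 y : 0 <= G y by exact: le_trans (normr_ge0 _) (dfG x y).
have derf z y : `]x - 1, x + 1[%classic z -> setT y -> derivable (f ^~ y) z 1.
  by move=> _ _; have [] := fdf z y.
have G_ub z y : `]x - 1, x + 1[%classic z -> setT y ->
    `|partial1of2 f z y| <= G y by move=> _ _; rewrite d1E.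
have cF := @derivable_under_integral R _ Y mu f setT measurableT x (x - 1)
  (x + 1) xI (fun z _ => intf z) derf G G_ge0 iG G_ub.
have dF := @differentiation_under_integral R _ Y mu f setT measurableT x (x - 1)
  (x + 1) xI (fun z _ => intf z) derf G G_ge0 iG G_ub.
apply: DeriveDef; first exact: cF.
rewrite -derive1E dF; apply: eq_Rintegral => y _; exact: d1E.
Qed.

(** The caller supplies all the [x]-derivatives of the integrand as one family [f], each member with
    its own integrable majorant. By induction the [n]-th derivative of the integral is the integral
    of [f n]. *)
Lemma smooth_integral (R : realType) d (Y : measurableType d)
    (mu : {measure set Y -> \bar R}) (f : nat -> R -> Y -> R)
    (G : nat -> Y -> R) :
  (forall n (x : R) y, is_derive x 1 (f n ^~ y) (f n.+1 x y)) ->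
  (forall n x, measurable_fun setT (f n x)) ->
  (forall n, mu.-integrable setT (EFin \o G n)) ->
  (forall n x y, `|f n x y| <= G n y) ->
  smooth (fun x => Rintegral mu setT (f 0%N x)).
Proof.
move=> fdf mf iG fG.
have dF n (x : R) := is_derive_integral (fdf n) (mf n) (iG n) (iG n.+1) (fG n) (fG n.+1) x.
have E n : derive1n n (fun x => Rintegral mu setT (f 0%N x)) =
    (fun x => Rintegral mu setT (f n x)).
  elim: n => [//|n IH]; rewrite derive1nS IH; apply/funext => x.
  by rewrite derive1E; have [_ ->] := dF n x.
move=> n x; rewrite E; exact: (@ex_derive _ _ _ _ _ _ _ (dF n x)).
Qed.

(** * A smooth function vanishing on the negative half-line *)

(** The single term y^n / n! of the exponential series is at most e^y. This drives both the flatness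
    of [flat] at 0 and the decay of [weight]. *)
Lemma exprn_expRN_le (R : realType) (y : R) n : 0 <= y ->
  y ^+ n * expR (- y) <= n`!%:R.
Proof.
move=> y0; rewrite expRN ler_pdivrMr ?expR_gt0//.
case: n => [|n]; first by rewrite expr0 fact0 mul1r (le_trans _ (expR_ge1Dx y))// lerDl.
rewrite mulrC -ler_pdivrMr ?ltr0n ?fact_gt0//.
apply: le_trans (expR_ge1Dxn n y0).
by rewrite lerDr ler01.
Qed.

(* The derivative of [flat n] is [flat n.+2 - n * flat n.+1], which makes the
   whole family smooth at once. *)
Definition flat (R : realType) (n : nat) (x : R) : R :=
  if 0 < x then x^-1 ^+ n * expR (- x^-1) else 0.

Lemma flat_ge0 (R : realType) n (x : R) : 0 <= flat n x.
Proof.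
rewrite /flat; case: ifPn => // x0.
by rewrite mulr_ge0 ?expR_ge0// exprn_ge0// invr_ge0 ltW.
Qed.

(** The previous bound at y = 1/x with exponent n + 2; the two extra powers leave a factor x^2, so
    the difference quotient at 0 is O(x). *)
Lemma flat_le (R : realType) n (x : R) : 0 < x -> flat n x <= n.+2`!%:R * x ^+ 2.
Proof.
move=> x0; rewrite /flat x0.
have /= := @exprn_expRN_le R x^-1 n.+2.
rewrite invr_ge0 (ltW x0) => /(_ isT) H.
have x2 : 0 < x ^+ 2 by rewrite exprn_gt0.
rewrite -ler_pdivrMr//; apply: le_trans H.
by rewrite -exprVn mulrAC -exprD addn2.
Qed.

Lemma is_derive_flat0 (R : realType) n : is_derive (0 : R) 1 (@flat R n) 0.
Proof.
have H : (fun h : R => h^-1 *: (flat n (h *: 1 + 0) - flat n (0 : R))) x @[x --> (0 : R)^'] --> (0 : R).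
  apply/cvgrPdist_le => /= e e0.
  pose C : R := n.+2`!%:R.
  have C0 : 0 < C by rewrite ltr0n fact_gt0.
  near=> h.
  have h0 : h != 0 by near: h; exact: nbhs_dnbhs_neq.
  rewrite sub0r normrN addr0 scaler1 /GRing.scale/=.
  have -> : flat n (0 : R) = 0 by rewrite /flat ltxx.
  rewrite subr0.
  have [hp|hn] := ltP 0 h; last by rewrite /flat ltNge hn/= mulr0 normr0 ltW.
  rewrite ger0_norm ?mulr_ge0 ?flat_ge0// ?invr_ge0 ?(ltW hp)//.
  rewrite mulrC ler_pdivrMr// (le_trans (flat_le n hp))// -/C.
  rewrite expr2 mulrA ler_pM2r// mulrC -ler_pdivlMr//.
  have : `|h| <= e / C.
    by near: h; apply: dnbhs0_le; rewrite divr_gt0.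
  by rewrite gtr0_norm.
apply: DeriveDef; last exact/cvg_lim.
by apply/cvg_ex; exists 0; exact: H.
Unshelve. all: by end_near. Qed.

Lemma is_derive_flat (R : realType) n (x : R) :
  is_derive x 1 (@flat R n) (flat n.+2 x - n%:R * flat n.+1 x).
Proof.
have [->|x0] := eqVneq x 0.
  have -> : flat n.+2 0 - n%:R * flat n.+1 0 = (0 : R).
    by rewrite /flat ltxx mulr0 subr0.
  exact: is_derive_flat0.
(* Away from 0 the case distinction in [flat] is locally constant, so the derivative is that of the
   explicit formula or of 0. *)
have [xp|xn] := ltP 0 x.
  pose g (y : R) := y^-1 ^+ n * expR (- y^-1).
  have gE : {near x, g =1 flat n}.
    near=> y; rewrite /flat ifT//; near: y; exact: lt_nbhsr.
  suff /(near_eq_is_derive gE) : is_derive x 1 g (flat n.+2 x - n%:R * flat n.+1 x) by [].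
  have dV : is_derive x 1 (fun y : R => y^-1) (- x ^- 2).
    have := @is_deriveV _ id x 1 1 x0 (is_derive_id x (1:R)).
    by rewrite scaler1.
  have d1 := is_deriveX n dV.
  have d2 := @is_derive1_comp _ expR (fun y => - y^-1) x _ _
    (is_derive_expR (- x^-1)) (is_deriveN dV).
  rewrite exprfctE in d1; have H := is_derive_mul d1 d2.
  apply: (is_derive_eq H); rewrite /flat xp /GRing.scale/= opprK !exprVn.
  case: n {g gE d1 H} => [|n].
    by rewrite !mul0r expr0 invr1 !mul1r; ring.
  rewrite /= !exprS; field.
  by rewrite x0 expf_neq0.
have {}xn : x < 0 by rewrite lt_neqAle x0.
have gE : {near x, cst 0 =1 flat n}.
  near=> y; rewrite /flat ifF//; apply/negbTE; rewrite -leNgt ltW//.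
  near: y; exact: lt_nbhsl.
have -> : flat n.+2 x - n%:R * flat n.+1 x = (0 : R).
  by rewrite /flat ltNge (ltW xn)/= mulr0 subr0.
by have /(near_eq_is_derive gE) := is_derive_cst (0 : R) x (1 : R).
Unshelve. all: by end_near. Qed.

Lemma smooth_flat (R : realType) n : smooth (@flat R n).
Proof.
apply/smooth_nderivable => k.
elim: k n => [|k IH] n; first exact (@nderivable0 R _).
apply: (@nderivableS _ _ _ _ (fun x => is_derive_flat n x)).
have E : (fun x : R => flat n.+2 x - n%:R * flat n.+1 x) =
         (fun x => flat n.+2 x + - n%:R * flat n.+1 x).
  by apply/funext => x; rewrite mulNr.
rewrite E.
exact (nderivableD (IH n.+2)
  (nderivableM ((smooth_nderivable _).1 (@smooth_cst R (- n%:R)) k) (IH n.+1))).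
Qed.

(** * Lebesgue integrals *)

(** Lebesgue measure is determined by its values on half-open intervals, and x -> c - x turns ]a, b]
    into [c - b, c - a[, of equal length. *)
Lemma lebesgue_measure_reflect (R : realType) (c : R) (A : set R) :
  measurable A ->
  pushforward (@lebesgue_measure R)
    ((fun x => c - x) : measurableTypeR R -> measurableTypeR R) A =
  lebesgue_measure A.
Proof.
move=> mA; have mphi : measurable_fun setT
    ((fun x => c - x) : measurableTypeR R -> measurableTypeR R).
  by apply: measurable_funB.
apply/esym.
pose nu : {measure set (measurableTypeR R) -> \bar R} :=
  measure_function_pushforward__canonical__measure_function_Measure
   (@lebesgue_measure R) mphi.
apply: (@lebesgue_measure_unique R nu) => //= _ [[a b]] _ <-.
rewrite /nu /= /pushforward /=.
have -> : (fun x : R => c - x) @^-1` `]a, b]%classic = `[c - b, c - a[%classic.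
  apply/seteqP; split => x /=; rewrite !in_itv/= => /andP[? ?];
    apply/andP; split; lra.
rewrite !lebesgue_measure_itv/= !lte_fin.
rewrite (_ : (c - b < c - a) = (a < b)); last by apply/idP/idP => ?; lra.
by case: ifPn => // _; rewrite -!EFinB; congr EFin; lra.
Qed.

(** Used with c = 0 for parity arguments and with c = t for the substitution u = t - x in the
    transform of an autocorrelation. *)
Lemma integral_reflect (R : realType) (c : R) (f : R -> R) :
  (@lebesgue_measure R).-integrable setT (EFin \o f) ->
  (@lebesgue_measure R).-integrable setT (EFin \o (fun x => f (c - x))) /\
  Rintegral lebesgue_measure setT (fun x => f (c - x)) =
  Rintegral lebesgue_measure setT f.
Proof.
move=> intf.
have mf : measurable_fun setT (EFin \o f) by exact: measurable_int intf.
have mphi : measurable_fun setT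
    ((fun x => c - x) : measurableTypeR R -> measurableTypeR R).
  by apply: measurable_funB.
have intg : (@lebesgue_measure R).-integrable setT (EFin \o (fun x => f (c - x))).
  apply/integrableP; split.
    exact: (measurableT_comp mf mphi).
  have /integrableP[_] := intf; apply: le_lt_trans.
  have := @ge0_integral_pushforward _ _ _ _ R _ mphi (@lebesgue_measure R) setT (abse \o (EFin \o f)).
  rewrite preimage_setT => <- //; last first.
    by move=> y _; exact: abse_ge0.
    exact: measurableT_comp.
  rewrite le_eqVlt; apply/orP; left; apply/eqP.
  by apply: eq_measure_integral => B mB _; exact: lebesgue_measure_reflect.
split => //; congr fine.
have := @integral_pushforward _ _ _ _ R _ mphi (@lebesgue_measure R) setT (EFin \o f) mf.
rewrite preimage_setT => /(_ intg measurableT) <-.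
by apply: eq_measure_integral => B mB _; exact: lebesgue_measure_reflect.
Qed.

(** The product majorant u(x) v(y) gives integrability on the product space by Tonelli.
    Integrability of the inner integral is returned as well, since a lower bound on the outer
    integral needs it. *)
Lemma Rintegral_Fubini (R : realType) d1 d2 (X : measurableType d1)
    (Y : measurableType d2) (m1 : {sigma_finite_measure set X -> \bar R})
    (m2 : {sigma_finite_measure set Y -> \bar R}) (f : X -> Y -> R)
    (u : X -> R) (v : Y -> R) :
  measurable_fun setT (fun z : X * Y => f z.1 z.2) ->
  m1.-integrable setT (EFin \o u) -> m2.-integrable setT (EFin \o v) ->
  (forall x y, `|f x y| <= u x * v y) ->
  m1.-integrable setT (EFin \o (fun x => Rintegral m2 setT (f x))) /\
  Rintegral m1 setT (fun x => Rintegral m2 setT (f x)) =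
  Rintegral m2 setT (fun y => Rintegral m1 setT (f ^~ y)).
Proof.
move=> mf iu iv fuv.
have mfx x : measurable_fun setT (f x).
  exact: (measurableT_comp mf (measurable_pair1 x)).
have mfy y : measurable_fun setT (f ^~ y).
  exact: (measurableT_comp mf (measurable_pair2 y)).
have ifx x : m2.-integrable setT (EFin \o f x).
  apply: (le_integrable measurableT _ _ (integrableZl measurableT (u x) iv)).
    exact/measurable_EFinP.
  by move=> y _ /=; rewrite lee_fin (le_trans (fuv x y))// ler_norm.
have ify y : m1.-integrable setT (EFin \o f ^~ y).
  apply: (le_integrable measurableT _ _ (integrableZr measurableT (v y) iu)).
    exact/measurable_EFinP.
  by move=> x _ /=; rewrite lee_fin (le_trans (fuv x y))// ler_norm.
pose F (z : X * Y) := (f z.1 z.2)%:E.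
have mF : measurable_fun setT F by exact/measurable_EFinP.
have iF : (m1 \x m2)%E.-integrable setT F.
  apply/(integrable12ltyP m1 m2 mF).
  pose V := Rintegral m2 setT (fun y => `|v y|).
  have iV : m2.-integrable setT (fun y => `|v y|%:E).
    exact: integrable_norm.
  have VE : (\int[m2]_y `|v y|%:E)%E = V%:E.
    by rewrite /V /Rintegral fineK//; exact: integrable_fin_num.
  apply: (@le_lt_trans _ _ (\int[m1]_x (`|u x| * V)%:E)%E).
    apply: ge0_le_integral => //.
    - by move=> x _; apply: integral_ge0.
    - apply: (measurable_fun_fubini_tonelli_F (abse \o F)).
        exact: measurableT_comp.
      by move=> z; exact: abse_ge0.
    - apply/measurable_EFinP/measurable_funM => //.
      apply: measurableT_comp => //.
      by apply/measurable_EFinP; exact: measurable_int iu.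
    - move=> x _; rewrite EFinM -VE -ge0_integralZl//; last exact: measurable_int iV.
      apply: ge0_le_integral => //.
      + apply: measurableT_comp => //.
        exact: (measurableT_comp mF (measurable_pair1 x)).
      + by apply: measurable_funeM; exact: measurable_int iV.
      + move=> y _; rewrite /F /= lee_fin (le_trans (fuv x y))//.
        by rewrite -normrM ler_norm.
  have : m1.-integrable setT (fun x => `|u x|%:E * V%:E)%E.
    by apply: integrableZr => //; exact: integrable_norm.
  move=> /(integrable_lty measurableT); apply: le_lt_trans.
  by rewrite le_eqVlt; apply/orP; left; apply/eqP; apply: eq_integral.
have EF x : (Rintegral m2 setT (f x))%:E = (\int[m2]_y F (x, y))%E.
  by rewrite /Rintegral fineK//; exact: integrable_fin_num (ifx x).
split.
  rewrite (_ : EFin \o _ = fubini_F m2 F); first exact: integrable_fubini_F.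
  by apply/funext => x; rewrite /= EF.
congr fine.
transitivity (\int[m1]_x \int[m2]_y F (x, y))%E.
  by apply: eq_integral => x _; exact: EF.
rewrite (Fubini iF); apply: eq_integral => y _.
by rewrite /Rintegral fineK//; exact: integrable_fin_num (ify y).
Qed.

Lemma integrable_bounded_support (R : realType) (f : R -> R) (r M : R) :
  measurable_fun setT f -> (forall x, `|f x| <= M) ->
  (forall x, r < `|x| -> f x = 0) ->
  (@lebesgue_measure R).-integrable setT (EFin \o f).
Proof.
move=> mf fM fr.
have := @integrable_indic_itv R (- r) r true false.
move=> /(integrableZl measurableT M).
apply: le_integrable => //; first exact/measurable_EFinP.
move=> x _ /=; rewrite lee_fin.
have [xr|xr] := ltP r `|x|; first by rewrite fr// normr0.
rewrite (le_trans (fM x))// indicE mem_set ?mulr1 ?ler_norm//.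
by rewrite /= in_itv/= -ler_norml.
Qed.

(** Comparison with [c] times the indicator of [a, b]. It yields the positivity of integrals and the
    restriction to a window of frequencies. *)
Lemma Rintegral_ge_itv (R : realType) (f : R -> R) (a b c : R) :
  (@lebesgue_measure R).-integrable setT (EFin \o f) ->
  (forall x, 0 <= f x) -> a <= b -> (forall x, a <= x <= b -> c <= f x) ->
  c * (b - a) <= Rintegral lebesgue_measure setT f.
Proof.
move=> intf f0 ab fc.
pose I := [set` Interval (BSide true a) (BSide false b)].
have iI := @integrable_indic_itv R a b true false.
have E : Rintegral lebesgue_measure setT (fun x => c * \1_I x) = c * (b - a).
  rewrite RintegralZl//; congr (_ * _).
  have mI : lebesgue_measure (`[a, b]%classic : set R) = (b - a)%:E.
    rewrite lebesgue_measure_itv/= lte_fin; case: ltP => [//|ba].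
    by rewrite (_ : b = a) ?subrr//; apply/eqP; rewrite eq_le ba ab.
  rewrite /Rintegral integral_indic//; last exact: measurable_itv.
  by rewrite setIT -[RHS]/(fine (b - a)%:E) -mI.
rewrite -E; apply: le_Rintegral => //.
  by have := integrableZl measurableT c iI.
move=> x _; rewrite indicE; case: (boolP (x \in I)) => xI.
  rewrite mulr1 fc//; move: xI; rewrite inE /I/= in_itv/=; exact.
by rewrite mulr0.
Qed.

Lemma continuous_bounded_support (R : realType) (f : R -> R) (r : R) :
  continuous f -> (forall x, r < `|x| -> f x = 0) ->
  exists M, forall x, `|f x| <= M.
Proof.
move=> cf fr.
have /compact_bounded[M [_ HM]] : compact (f @` `[- r, r]%classic).
  apply: continuous_compact; last exact: segment_compact.
  exact: continuous_subspaceT.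
exists (`|M| + 1) => x; have [xr|xr] := ltP r `|x|.
  by rewrite fr// normr0 addr_ge0.
apply: (HM (`|M| + 1)); first by rewrite (le_lt_trans (ler_norm M))// ltrDl.
by exists x => //; rewrite /= in_itv/= -ler_norml.
Qed.

(** The condition r < |x| is open, so [f] vanishes near each such point. *)
Lemma derive1_support (R : realType) (f : R -> R) (r : R) :
  (forall x, r < `|x| -> f x = 0) -> forall x, r < `|x| -> derive1 f x = 0.
Proof.
move=> fr x xr; rewrite derive1E.
have -> : 'D_1 f x = 'D_1 (cst 0) x.
  apply: near_eq_derive; near=> y; rewrite fr//.
  near: y.
  have /cvgr_gt := @norm_continuous _ _ x.
  by apply.
exact: derive_cst.
Unshelve. all: by end_near. Qed.

(** * Bumps with nonnegative Fourier transform *)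

(** The witness is the product of [flat 0] at r + x and at r - x: each factor kills one side, and x
    -> -x swaps them. *)
Lemma bump_exists (R : realType) (r : R) : 0 < r -> exists eta : R -> R,
  [/\ smooth eta, (forall x, eta (- x) = eta x), (forall x, 0 <= eta x),
      (forall x, r < `|x| -> eta x = 0) & 0 < eta 0].
Proof.
move=> r0; exists (fun x => flat 0 (r + 1 * x) * flat 0 (r + -1 * x)); split.
- exact (smoothM (@smooth_affine R _ r 1 (@smooth_flat R 0))
                 (@smooth_affine R _ r (-1) (@smooth_flat R 0))).
- by move=> x; rewrite mulrC !mulrN !mulNr !mul1r opprK.
- by move=> x; rewrite mulr_ge0// flat_ge0.
- move=> x; rewrite /flat ltr_normr => /orP[rx|rx].
    by rewrite (_ : 0 < r + -1 * x = false) ?mulr0//; apply/negbTE; rewrite -leNgt; lra.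
  by rewrite (_ : 0 < r + 1 * x = false) ?mul0r//; apply/negbTE; rewrite -leNgt; lra.
- by rewrite !mulr0 addr0 /flat r0 expr0 mul1r mulr_gt0 ?expR_gt0.
Qed.

Lemma Rintegral_bump_gt0 (R : realType) (f : R -> R) :
  continuous f -> (forall x, 0 <= f x) -> 0 < f 0 ->
  (@lebesgue_measure R).-integrable setT (EFin \o f) ->
  0 < Rintegral lebesgue_measure setT f.
Proof.
move=> cf f_ge0 f0 intf.
have /cvgr_ge /(_ (f 0 / 2)) := cf 0.
have f2 : f 0 / 2 < f 0 by lra.
move=> /(_ f2) /nbhs_ballP [e /= e0 He].
have : f 0 / 2 * (e / 2 - 0) <= Rintegral lebesgue_measure setT f.
  apply: Rintegral_ge_itv => //; first by lra.
  move=> x /andP[x0 xe]; apply: He.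
  by rewrite /ball/= sub0r normrN ger0_norm//; lra.
by apply: lt_le_trans; rewrite subr0 mulr_gt0 ?divr_gt0.
Qed.

Lemma measurable_fun_shift (R : realType) (f : R -> R) (c : R) :
  continuous f -> measurable_fun setT (fun t : R => f (t - c)).
Proof.
move=> cf; apply: (measurableT_comp (continuous_measurable_fun cf)).
exact: measurable_funB.
Qed.

(** For even [f] this is the convolution square of [f]; its transform is the squared modulus of that
    of [f], hence nonnegative. *)
Definition autocorrelation (R : realType) (f : R -> R) (x : R) : R :=
  Rintegral lebesgue_measure setT (fun t => f t * f (t - x)).

(** All [x]-derivatives fall on the shifted factor f(t - x), each one contributing a sign, and
    |f(t)| times the maximum of the [n]-th derivative is an integrable majorant. *)
Lemma smooth_autocorrelation (R : realType) (f : R -> R) (r : R) :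
  smooth f -> (forall x, r < `|x| -> f x = 0) -> smooth (autocorrelation f).
Proof.
move=> sf fr.
have supp n : forall x, r < `|x| -> derive1n n f x = 0.
  by elim: n => [//|n IH] x; rewrite derive1nS; exact: derive1_support.
have /choice[M HM] n : exists M, forall x, `|derive1n n f x| <= M.
  apply: continuous_bounded_support (supp n).
  exact: smooth_continuous (@smooth_derive1n R f n sf).
pose F n x t : R := f t * (-1) ^+ n * derive1n n f (t + -1 * x).
have -> : autocorrelation f = (fun x => Rintegral lebesgue_measure setT (F 0%N x)).
  apply/funext => x; apply: eq_Rintegral => t _.
  by rewrite /F expr0 mulr1 mulN1r.
have intf : (@lebesgue_measure R).-integrable setT (EFin \o f).
  apply: integrable_bounded_support fr; last exact: HM 0%N.
  exact: continuous_measurable_fun (smooth_continuous sf).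
apply: (@smooth_integral R _ _ lebesgue_measure F (fun n t => `|f t| * M n)).
- move=> n x t.
  have dD : is_derive (t + -1 * x) 1 (derive1n n f) (derive1n n.+1 f (t + -1 * x)).
    by rewrite derive1nS derive1E; apply: derivableP; exact: sf.
  have := is_derive_mul (is_derive_cst (f t * (-1) ^+ n) x (1 : R)) (is_derive_affine dD).
  move=> H; apply: (is_derive_eq H).
  by rewrite mulr0 addr0 /cst /F exprS; ring.
- move=> n x; apply: measurable_funM.
    apply: measurable_funM => //.
    exact: continuous_measurable_fun (smooth_continuous sf).
  rewrite mulN1r; apply: measurable_fun_shift.
  exact: smooth_continuous (@smooth_derive1n R f n sf).
- by move=> n; have := integrableZr measurableT (M n) (integrable_norm intf).
- move=> n x t; rewrite /F !normrM normrX normrN normr1 expr1n mulr1.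
  by rewrite ler_wpM2l.
Qed.

(** When |x| > 2r, the points t and t - x cannot both lie in [-r, r]. *)
Lemma autocorrelation_support (R : realType) (f : R -> R) (r : R) :
  (forall x, r < `|x| -> f x = 0) ->
  forall x, r + r < `|x| -> autocorrelation f x = 0.
Proof.
move=> fr x xr; rewrite /autocorrelation.
rewrite (_ : (fun t => _) = cst 0).
  by rewrite Rintegral_cst// mul0r.
apply/funext => t; have [tr|tr] := ltP r `|t|; first by rewrite fr ?mul0r.
rewrite (fr (t - x)) ?mulr0// distrC.
by rewrite (lt_le_trans _ (lerB_dist x t))//; lra.
Qed.

Lemma autocorrelation_even (R : realType) (f : R -> R) (r : R) :
  continuous f -> (forall x, r < `|x| -> f x = 0) ->
  (forall x, f (- x) = f x) ->
  forall x, autocorrelation f (- x) = autocorrelation f x.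
Proof.
move=> cf fr fe x.
have [M HM] := continuous_bounded_support cf fr.
have M0 : 0 <= M by exact: le_trans (HM 0).
have : (@lebesgue_measure R).-integrable setT (EFin \o (fun t => f t * f (t - x))).
  apply: (@integrable_bounded_support _ _ r (M * M)).
  - apply: measurable_funM; last exact: measurable_fun_shift.
    exact: continuous_measurable_fun.
  - by move=> t; rewrite normrM ler_pM.
  - by move=> t tr; rewrite fr ?mul0r.
move=> /(integral_reflect 0)[_]; rewrite -/(autocorrelation f x) => <-.
by apply: eq_Rintegral => t _; rewrite sub0r fe -(fe (- t - x)) opprB !opprK addrC.
Qed.

Lemma measurable_cosM (R : realType) (c : R) :
  measurable_fun setT (fun x : R => cos (c * x)).
Proof.
apply: (measurableT_comp (continuous_measurable_fun (@continuous_cos R))).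
exact: measurable_funM.
Qed.

Lemma measurable_sinM (R : realType) (c : R) :
  measurable_fun setT (fun x : R => sin (c * x)).
Proof.
apply: (measurableT_comp (continuous_measurable_fun (@continuous_sin R))).
exact: measurable_funM.
Qed.

Lemma integrable_mul_le1 (R : realType) (f g : R -> R) :
  measurable_fun setT g -> (forall x, `|g x| <= 1) ->
  (@lebesgue_measure R).-integrable setT (EFin \o f) ->
  (@lebesgue_measure R).-integrable setT (EFin \o (fun x => g x * f x)).
Proof.
move=> mg g1 intf.
have mEf : measurable_fun setT (EFin \o f) by exact: measurable_int intf.
have mf : measurable_fun setT f by exact/measurable_EFinP.
have mgf := measurable_funM mg mf.
apply: (le_integrable measurableT _ _ intf); first exact/measurable_EFinP.
by move=> x _; rewrite /= lee_fin normrM ler_piMl.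
Qed.

(** Exchange the integrals in x and t, substitute u = t - x, and expand cos (k t - k u): the double
    integral splits into a cosine product and a sine product. *)
Lemma fourier_autocorrelation (R : realType) (f : R -> R) (r : R) :
  continuous f -> (forall x, 0 <= f x) -> (forall x, r < `|x| -> f x = 0) ->
  forall k, fourier_re (autocorrelation f) k =
            fourier_re f k ^+ 2 + fourier_im f k ^+ 2.
Proof.
move=> cf f0 fr k.
have [M HM] := continuous_bounded_support cf fr.
have mf : measurable_fun setT f by exact: continuous_measurable_fun.
have M0 : 0 <= M by exact: le_trans (HM 0).
have intf : (@lebesgue_measure R).-integrable setT (EFin \o f).
  exact: integrable_bounded_support mf HM fr.
have intc := integrable_mul_le1 (measurable_cosM k) (fun x => cos_max (k * x)) intf.
have ints := integrable_mul_le1 (measurable_sinM k) (fun x => sin_max (k * x)) intf.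
pose C := fourier_re f k.
pose S := Rintegral lebesgue_measure setT (fun x => sin (k * x) * f x).
pose g x t : R := f t * (cos (k * x) * f (t - x)).
have shift t : Rintegral lebesgue_measure setT (g ^~ t) =
    C * (cos (k * t) * f t) + S * (sin (k * t) * f t).
  pose h u := f t * cos (k * t) * (cos (k * u) * f u) +
              f t * sin (k * t) * (sin (k * u) * f u).
  have ic := integrableZl measurableT (f t * cos (k * t)) intc.
  have isn := integrableZl measurableT (f t * sin (k * t)) ints.
  have inth : (@lebesgue_measure R).-integrable setT (EFin \o h).
    by have := integrableD measurableT ic isn.
  have [_ E] := integral_reflect t inth.
  transitivity (Rintegral lebesgue_measure setT (fun u => h (t - u))).
    apply: eq_Rintegral => u _; rewrite /g /h.
    have -> : k * u = k * t - k * (t - u) by ring.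
    by rewrite cosB; ring.
  rewrite E /h RintegralD// !RintegralZl// /C /fourier_re -/S; ring.
have -> : fourier_im f k ^+ 2 = S * S by rewrite /fourier_im -/S sqrrN expr2.
(* Majorant in x for Fubini: f(t) f(t - x) is nonzero only if |x| <= 2r, and there |cos (k x) f(t -
   x)| <= M. *)
pose u (x : R) := M * \1_[set` Interval (BSide true (- (r + r))) (BSide false (r + r))] x.
transitivity (Rintegral lebesgue_measure setT
    (fun x => Rintegral lebesgue_measure setT (g x))).
  apply: eq_Rintegral => x _; rewrite /autocorrelation -RintegralZl//.
    by apply: eq_Rintegral => t _; rewrite /g; ring.
  apply: (@integrable_bounded_support _ _ r (M * M)).
  - by apply: measurable_funM => //; exact: measurable_fun_shift.
  - by move=> t; rewrite normrM ler_pM.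
  - by move=> t tr; rewrite fr ?mul0r.
have mg : measurable_fun setT (fun z : R * R => g z.1 z.2).
  apply: measurable_funM; first exact: (measurableT_comp mf).
  apply: measurable_funM; first exact: (measurableT_comp (measurable_cosM k)).
  by apply: (measurableT_comp mf); exact: measurable_funB.
have iu : (@lebesgue_measure R).-integrable setT (EFin \o u).
  have := @integrable_indic_itv R (- (r + r)) (r + r) true false.
  by move=> /(integrableZl measurableT M).
have guf x t : `|g x t| <= u x * f t.
  rewrite /g /u.
  have [tr|tr] := ltP r `|t|; first by rewrite fr// !(mul0r, mulr0) normr0.
  rewrite indicE; have [xr|xr] := ltP (r + r) `|x|.
    rewrite (fr (t - x)) ?mulr0 ?normr0 ?mulr_ge0//.
    by rewrite distrC (lt_le_trans _ (lerB_dist x t))//; lra.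
  rewrite mem_set; last by rewrite /= in_itv/= -ler_norml.
  rewrite mulr1 normrM (ger0_norm (f0 t)) mulrC ler_wpM2r// normrM.
  by rewrite -[leRHS]mul1r ler_pM// cos_max.
have [_ ->] := @Rintegral_Fubini R _ _ _ _ lebesgue_measure lebesgue_measure g u f mg iu intf guf.
transitivity (Rintegral lebesgue_measure setT
  (fun t => C * (cos (k * t) * f t) + S * (sin (k * t) * f t))).
  by apply: eq_Rintegral => t _; exact: shift.
have ic := integrableZl measurableT C intc.
have isn := integrableZl measurableT S ints.
by rewrite RintegralD// !RintegralZl// -/S expr2.
Qed.

Lemma sin_le_id (R : realType) (x : R) : 0 <= x -> sin x <= x.
Proof.
move=> x0; rewrite -subr_ge0.
have d (y : R) : is_derive y 1 (fun y => y + -1 * sin y) (1 + (-1 * cos y + sin y * 0)).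
  exact (is_derive_add (is_derive_id y (1 : R))
    (is_derive_mul (is_derive_cst (-1 : R) y (1 : R)) (is_derive_sin y))).
have c : continuous (fun y : R => y + -1 * sin y).
  by apply: derivable1_continuous => y; have [] := d y.
have := @ger0_derive1_ndecr R (fun y => y + -1 * sin y) 0 x.
move=> /(_ _ _ _ 0 x (lexx 0) x0 (lexx x)).
rewrite sin0 mulr0 addr0 mulN1r; apply.
- by move=> y _; have [] := d y.
- move=> y _; rewrite derive1E; have [_ ->] := d y.
  by rewrite mulr0 addr0 mulN1r subr_ge0 cos_le1.
- exact: continuous_subspaceT.
Qed.

(** On the half-line x >= 0 the function cos y + y^2 / 2 has derivative y - sin y >= 0 and value 1
    at 0. *)
Lemma cos_ge_quad (R : realType) (x : R) : 1 - x ^+ 2 / 2 <= cos x.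
Proof.
wlog x0 : x / 0 <= x => [H|].
  have [/H//|/ltW x0] := leP 0 x.
  by have := H (- x); rewrite oppr_ge0 sqrrN cosN; exact.
rewrite -subr_ge0.
pose f (y : R) := cos y + 2^-1 * (y * y).
have d (y : R) : is_derive y 1 f
    (- sin y + (2^-1 * (y * 1 + y * 1) + (y * y) * 0)).
  exact (is_derive_add (is_derive_cos y)
    (is_derive_mul (is_derive_cst (2^-1 : R) y (1 : R))
      (is_derive_mul (is_derive_id y (1 : R)) (is_derive_id y (1 : R))))).
have c : continuous f.
  by apply: derivable1_continuous => y; have [] := d y.
have := @ger0_derive1_ndecr R f 0 x.
move=> /(_ _ _ _ 0 x (lexx 0) x0 (lexx x)) H.
have {H} : f 0 <= f x.
  apply: H.
  - by move=> y _; have [] := d y.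
  - move=> y; rewrite in_itv/= => /andP[y0 _]; rewrite derive1E; have [_ ->] := d y.
    by have := sin_le_id (ltW y0); lra.
  - exact: continuous_subspaceT.
rewrite /f cos0 !mul0r mulr0 expr2; lra.
Qed.

Lemma fourier_re0 (R : realType) (f : R -> R) :
  fourier_re f 0 = Rintegral lebesgue_measure setT f.
Proof. by apply: eq_Rintegral => x _; rewrite mul0r cos0 mul1r. Qed.

(** Autocorrelation of a bump of half-width a / 2. Its integral is its transform at 0, which is at
    least the square of the integral of the bump. *)
Lemma positive_definite_bump (R : realType) (a : R) : 0 < a ->
  exists psi : R -> R,
  [/\ smooth psi, (forall x, psi (- x) = psi x), (forall x, 0 <= psi x),
      (forall x, a < `|x| -> psi x = 0) &
      (forall k, 0 <= fourier_re psi k) /\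
      0 < Rintegral lebesgue_measure setT psi].
Proof.
move=> a0; have a2 : 0 < a / 2 by rewrite divr_gt0.
have [f [sf fe f0 fs fpos]] := bump_exists a2.
have cf := smooth_continuous sf.
have aa : a = a / 2 + a / 2 by lra.
exists (autocorrelation f); split.
- exact: smooth_autocorrelation sf fs.
- exact: autocorrelation_even cf fs fe.
- by move=> x; apply: Rintegral_ge0 => t _; rewrite mulr_ge0.
- by rewrite aa; exact: autocorrelation_support.
- split=> [k|].
    by rewrite (fourier_autocorrelation cf f0 fs) addr_ge0// sqr_ge0.
  rewrite -fourier_re0 (fourier_autocorrelation cf f0 fs) fourier_re0 ltr_pwDl ?sqr_ge0//.
  rewrite exprn_gt0//; apply: Rintegral_bump_gt0 => //.
  have [M HM] := continuous_bounded_support cf fs.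
  apply: integrable_bounded_support HM fs; exact: continuous_measurable_fun.
Qed.

(** * The frequency weight *)

(** The reference majorant 1 / (1 + s^2) against which all moments of the weight are compared. *)
Lemma integrable_oneDsqrV (R : realType) :
  (@lebesgue_measure R).-integrable setT (EFin \o (fun s : R => (oneDsqr s)^-1)).
Proof.
have pos (s : R) : 0 <= (oneDsqr s)^-1.
  by rewrite invr_ge0 (le_trans ler01)// oneDsqr_ge1.
have cV : continuous (fun s : R => (oneDsqr s)^-1) by exact: continuous_oneDsqrV.
apply/integrableP; split.
  by apply/measurable_EFinP; exact: continuous_measurable_fun.
have -> : (\int[@lebesgue_measure R]_s
      `|(EFin \o (fun s : R => (oneDsqr s)^-1%R)) s| =
    \int[@lebesgue_measure R]_s ((oneDsqr s)^-1%R)%:E)%E.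
  by apply: eq_integral => s _; rewrite /= ger0_norm.
rewrite (ge0_symfun_integralT pos cV); last first.
  by move=> s; rewrite /oneDsqr /= sqrrN.
by rewrite -set_itvcy integral0y_oneDsqr -EFinM ltry.
Qed.

(** Here [oneDsqr s] is 1 + s^2; the theorem takes [b] to be half of beta = 1 - gamma. *)
Definition weight (R : realType) (b s : R) : R := expR (- ((oneDsqr s) `^ b)).

Lemma weight_le (R : realType) (b s t : R) : 0 < b -> 0 <= s -> s <= t ->
  weight b t <= weight b s.
Proof.
move=> b0 s0 st; rewrite ler_expR lerN2.
apply: ge0_ler_powR; first exact: ltW.
- by rewrite nnegrE (le_trans ler01)// oneDsqr_ge1.
- by rewrite nnegrE (le_trans ler01)// oneDsqr_ge1.
- by rewrite /oneDsqr lerD2l; nra.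
Qed.

Lemma measurable_weight (R : realType) (b : R) : measurable_fun setT (@weight R b).
Proof.
apply: (measurableT_comp (continuous_measurable_fun (@continuous_expR R))).
apply: measurableT_comp => //.
apply: (measurableT_comp (measurable_powR b)).
exact: continuous_measurable_fun (@continuous_oneDsqr R).
Qed.

(** Put u = 1 + s^2 and choose N with b N >= n + 1. Then |s|^n u <= u^(n+1) <= (u^b)^N, and y^N
    e^(-y) <= N! at y = u^b. *)
Lemma weight_moment_le (R : realType) (b : R) n : 0 < b ->
  exists C, forall s, `|s| ^+ n * weight b s <= C * (oneDsqr s)^-1.
Proof.
move=> b0.
have [N HN] : exists N : nat, n.+1%:R <= b * N%:R.
  exists (Num.bound (n.+1%:R / b)).
  rewrite mulrC -ler_pdivrMr// ltW// -[ltLHS]ger0_norm ?divr_ge0 ?ltW//.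
  by rewrite ger0_norm ?divr_ge0 ?(ltW b0)// archi_boundP ?divr_ge0 ?(ltW b0).
exists (N`!%:R) => s.
have u1 := oneDsqr_ge1 s; set u := oneDsqr s in u1 *.
have u0 : 0 < u by exact: lt_le_trans u1.
have su : `|s| <= u.
  rewrite /u /oneDsqr -real_normK ?num_real//.
  by have := sqr_ge0 (`|s| - 1); nra.
rewrite ler_pdivlMr//.
apply: (@le_trans _ _ (u ^+ n * weight b s * u)).
  by rewrite ler_wpM2r ?(ltW u0)// ler_wpM2r ?expR_ge0// lerXn2r ?nnegrE ?(ltW u0).
rewrite mulrAC -exprSr.
have := @exprn_expRN_le R (u `^ b) N (powR_ge0 _ _).
apply: le_trans; rewrite ler_wpM2r ?expR_ge0//.
rewrite -(powR_mulrn n.+1 (ltW u0)) -(powR_mulrn N (powR_ge0 u b)) -powRrM.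
exact: ler_powR.
Qed.

Lemma integrable_weight_moment (R : realType) (b : R) n : 0 < b ->
  (@lebesgue_measure R).-integrable setT
    (EFin \o (fun s => `|s| ^+ n * weight b s)).
Proof.
move=> b0; have [C HC] := weight_moment_le n b0.
have := integrableZl measurableT C (integrable_oneDsqrV R).
apply: le_integrable => //.
  apply/measurable_EFinP; apply: measurable_funM; last exact: measurable_weight.
  by apply: measurable_funX; exact: continuous_measurable_fun (@norm_continuous _ R).
move=> s _ /=; rewrite lee_fin ger0_norm ?mulr_ge0 ?expR_ge0// ?exprn_ge0//.
by rewrite (le_trans (HC s))// ler_norm.
Qed.

Lemma smooth_cos_transform (R : realType) (w : R -> R) :
  measurable_fun setT w ->
  (forall n, (@lebesgue_measure R).-integrable setT
    (EFin \o (fun s => `|s| ^+ n * w s))) ->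
  smooth (fun x => Rintegral lebesgue_measure setT (fun s => w s * cos (s * x))).
Proof.
move=> mw iw.
(* Differentiating a cosine shifts its phase by pi/2, so one formula covers the derivatives of every
   order. *)
pose F (n : nat) (x s : R) : R := w s * s ^+ n * cos (n%:R * (pi / 2) + s * x).
have -> : (fun x => Rintegral lebesgue_measure setT (fun s => w s * cos (s * x))) =
    (fun x => Rintegral lebesgue_measure setT (F 0%N x)).
  apply/funext => x; apply: eq_Rintegral => s _.
  by rewrite /F expr0 mulr1 mul0r add0r.
apply: (@smooth_integral R _ _ lebesgue_measure F
  (fun n s => `| `|s| ^+ n * w s|)).
- move=> n x s.
  have H := is_derive_mul (is_derive_cst (w s * s ^+ n) x (1 : R))
    (is_derive_affine (is_derive_cos (n%:R * (pi / 2) + s * x))).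
  apply: (is_derive_eq H).
  have -> : F n.+1 x s = w s * s ^+ n.+1 * (- sin (n%:R * (pi / 2) + s * x)).
    rewrite /F -cosDpihalf; congr (_ * cos _).
    by rewrite -natr1; ring.
  by rewrite mulr0 addr0 /cst exprS; ring.
- move=> n x; apply: measurable_funM.
    by apply: measurable_funM => //; exact: measurable_funX.
  apply: (measurableT_comp (continuous_measurable_fun (@continuous_cos R))).
  by apply: measurable_funD => //; exact: measurable_funM.
- by move=> n; have := integrable_norm (iw n).
- move=> n x s; rewrite /F !normrM !normrX normr_id mulrAC mulrC mulrA.
  by rewrite -mulrA ler_wpM2l ?exprn_ge0// ler_piMr// cos_max.
Qed.

(** * Modulated bumps *)

(** On the support of [psi] one has |q x| <= 1, hence cos (q x) >= 1 - 1/2. *)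
Lemma fourier_re_ge_half (R : realType) (psi : R -> R) (a q : R) :
  0 < a -> (@lebesgue_measure R).-integrable setT (EFin \o psi) ->
  (forall x, 0 <= psi x) -> (forall x, a < `|x| -> psi x = 0) ->
  `|q| <= a^-1 -> Rintegral lebesgue_measure setT psi / 2 <= fourier_re psi q.
Proof.
move=> a0 ip p0 ps qa.
rewrite mulrC -RintegralZl//; apply: le_Rintegral => //.
- by have := integrableZl measurableT 2^-1 ip.
- exact: integrable_mul_le1 (measurable_cosM q) (fun x => cos_max (q * x)) ip.
- move=> x _; have [xa|xa] := ltP a `|x|; first by rewrite ps// !mulr0.
  rewrite ler_wpM2r// (le_trans _ (cos_ge_quad (q * x)))//.
  have qx1 : `|q * x| <= 1.
    by rewrite normrM -(mulVf (lt0r_neq0 a0)) ler_pM.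
  have : (q * x) ^+ 2 <= 1.
    by rewrite -real_normK ?num_real// exprn_ile1.
  lra.
Qed.

Lemma fourier_re_mulcos (R : realType) (psi : R -> R) (k q : R) :
  (@lebesgue_measure R).-integrable setT (EFin \o psi) ->
  Rintegral lebesgue_measure setT (fun x => cos (k * x) * (1 + cos (q * x)) * psi x)
  = fourier_re psi k + (fourier_re psi (k + q) + fourier_re psi (k - q)) / 2.
Proof.
move=> ip.
have ic c := integrable_mul_le1 (measurable_cosM c) (fun x => cos_max (c * x)) ip.
have iD : (@lebesgue_measure R).-integrable setT
    (EFin \o (fun x => cos ((k + q) * x) * psi x + cos ((k - q) * x) * psi x)).
  by have := integrableD measurableT (ic (k + q)) (ic (k - q)).
have iD2 : (@lebesgue_measure R).-integrable setT
    (EFin \o (fun x => (cos ((k + q) * x) * psi x + cos ((k - q) * x) * psi x) / 2)).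
  by have := integrableZr measurableT 2^-1 iD.
rewrite /fourier_re -RintegralD// -RintegralZr// -RintegralD//.
apply: eq_Rintegral => x _.
by rewrite (mulrDl k q x) (mulrBl x k q) cosD cosB; field.
Qed.

Lemma modulated_bump (R : realType) (b : R) : 0 < b ->
  exists2 A, 0 < A & forall a, 0 < a -> exists g : R -> R,
  [/\ smooth g, (forall x, a < `|x| -> g x = 0), (forall x, 0 <= g x),
      (forall x, g (- x) = g x) &
      Rintegral lebesgue_measure setT g = 1 /\
      forall k, A * weight b (a * `|k| + 1) <= fourier_re g k].
Proof.
move=> b0; pose w := @weight R b.
have w0 s : 0 <= w s by exact: expR_ge0.
have mw : measurable_fun setT w by exact: measurable_weight.
have iwn n := @integrable_weight_moment R b n b0.
have iw : (@lebesgue_measure R).-integrable setT (EFin \o w).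
  by rewrite (_ : w = fun s => `|s| ^+ 0 * w s)//; apply/funext => s; rewrite expr0 mul1r.
pose W := Rintegral lebesgue_measure setT w.
have W0 : 0 < W.
  have := @Rintegral_ge_itv R w 0 1 (w 1) iw w0 ler01.
  rewrite subr0 mulr1 => H; apply: lt_le_trans (H _); first exact: expR_gt0.
  by move=> s /andP[s0 s1]; exact: weight_le.
(* The constant is (I / 4) / (2 W I): the lower bound [Glow] divided by the bound [NW] on the
   normalising integral. The factor I cancels, which makes it independent of [a]. *)
exists (8 * W)^-1; first by rewrite invr_gt0 mulr_gt0.
move=> a a0.
have [psi [sp pe p0 ps [phat I0]]] := positive_definite_bump a0.
set I := Rintegral _ _ _ in I0.
have cp := smooth_continuous sp.
have mp : measurable_fun setT psi by exact: continuous_measurable_fun.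
have ip : (@lebesgue_measure R).-integrable setT (EFin \o psi).
  by have [M HM] := continuous_bounded_support cp ps; exact: integrable_bounded_support mp HM ps.
pose K x := Rintegral lebesgue_measure setT (fun s => w s * cos (s * x)).
have iK x : (@lebesgue_measure R).-integrable setT (EFin \o (fun s => w s * cos (s * x))).
  have := integrable_mul_le1 (measurable_cosM x) (fun s => cos_max (x * s)) iw.
  rewrite (_ : (fun s => cos (x * s) * w s) = (fun s => w s * cos (s * x)))//.
  by apply/funext => s; rewrite mulrC (mulrC x).
have KW x : - W <= K x <= W.
  rewrite -ler_norml (le_trans (le_normr_Rintegral measurableT (iK x)))//.
  apply: le_Rintegral => //; first exact: integrable_norm (iK x).
  by move=> s _; rewrite normrM (ger0_norm (w0 s)) ler_piMr// cos_max.
have sK : smooth K by exact: smooth_cos_transform.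
have Ke x : K (- x) = K x.
  by apply: eq_Rintegral => s _; rewrite mulrN cosN.
(* Since |K| <= W, the modulating factor lies between 0 and 2 W. The shape [0 + a^-1 * x] is that of
   [smooth_affine]. *)
pose G x := psi x * (W + K (0 + a^-1 * x)).
have G0 x : 0 <= G x.
  by rewrite mulr_ge0//; have /andP[] := KW (0 + a^-1 * x); lra.
have GW x : G x <= 2 * W * psi x.
  by rewrite [leRHS]mulrC ler_wpM2l//; have /andP[] := KW (0 + a^-1 * x); lra.
have Ge x : G (- x) = G x by rewrite /G pe mulrN !add0r Ke.
have Gs x : a < `|x| -> G x = 0 by move=> xa; rewrite /G ps// mul0r.
have sG : smooth G.
  apply: (@smoothM R psi) => //.
  apply/smooth_nderivable => n.
  exact (nderivableD ((smooth_nderivable _).1 (@smooth_cst R W) n)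
    ((smooth_nderivable _).1 (@smooth_affine R K 0 a^-1 sK) n)).
have cG := smooth_continuous sG.
have iG : (@lebesgue_measure R).-integrable setT (EFin \o G).
  have [M HM] := continuous_bounded_support cG Gs.
  by apply: integrable_bounded_support HM Gs; exact: continuous_measurable_fun.
pose f k s x := w s * (cos (k * x) * (1 + cos (s / a * x)) * psi x).
have fint k s : Rintegral lebesgue_measure setT (f k s) = w s *
    (fourier_re psi k + (fourier_re psi (k + s / a) + fourier_re psi (k - s / a)) / 2).
  rewrite -fourier_re_mulcos// /f RintegralZl//.
  have i2 : (@lebesgue_measure R).-integrable setT (EFin \o (fun x => 2 * psi x)).
    by have := integrableZl measurableT 2 ip.
  apply: (le_integrable measurableT _ _ i2).
    apply/measurable_EFinP; apply: measurable_funM => //.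
    apply: measurable_funM; first exact: measurable_cosM.
    by apply: measurable_funD => //; exact: measurable_cosM.
  move=> x _; rewrite /= lee_fin !normrM ler_wpM2r// -[leRHS]mul1r.
  rewrite ler_pM ?cos_max// (le_trans (ler_normD _ _))// normr1 ger0_norm//.
  by have := cos_max (s / a * x); lra.
have mf k : measurable_fun setT
    (fun z : measurableTypeR R * measurableTypeR R => f k z.1 z.2).
  apply: measurable_funM; first exact: (measurableT_comp mw).
  apply: measurable_funM; last exact: (measurableT_comp mp).
  apply: measurable_funM; first exact: (measurableT_comp (measurable_cosM k)).
  apply: measurable_funD => //.
  apply: (measurableT_comp (continuous_measurable_fun (@continuous_cos R))).
  apply: measurable_funM; last exact: measurable_snd.
  by apply: measurable_funM => //; exact: measurable_fst.
have i2w : (@lebesgue_measure R).-integrable setT (EFin \o (fun s => 2 * w s)).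
  by have := integrableZl measurableT 2 iw.
have fle k s x : `|f k s x| <= 2 * w s * psi x.
  rewrite /f !normrM (ger0_norm (w0 s)) (ger0_norm (p0 x)) mulrA.
  rewrite ler_wpM2r// mulrC ler_wpM2r// -[leRHS]mul1r.
  rewrite ler_pM ?cos_max// (le_trans (ler_normD _ _))// normr1.
  by have := cos_max (s / a * x); lra.
have GE k : fourier_re G k =
    Rintegral lebesgue_measure setT (fun s => Rintegral lebesgue_measure setT (f k s)).
  have [_ ->] := @Rintegral_Fubini R _ _ _ _ lebesgue_measure lebesgue_measure
    (f k) (fun s => 2 * w s) psi (mf k) i2w ip (fle k).
  apply: eq_Rintegral => x _.
  rewrite /G /K add0r -RintegralD// mulrA -RintegralZl//; last first.
    by have := integrableD measurableT iw (iK (a^-1 * x)).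
  apply: eq_Rintegral => s _; rewrite /f.
  have -> : s * (a^-1 * x) = s / a * x by rewrite mulrA.
  change (expR (- oneDsqr s `^ b)) with (w s).
  by move: (w s) => ws; ring.
(* Keep only the frequencies s in [a|k|, a|k| + 1], an interval of length 1. There the weight is
   smallest at the right end, and | |k| - s/a | <= 1/a makes one shifted transform at least I / 2,
   which the average halves to I / 4. *)
have Glow k : w (a * `|k| + 1) * (I / 4) <= fourier_re G k.
  have [ifk _] := @Rintegral_Fubini R _ _ _ _ lebesgue_measure lebesgue_measure
    (f k) (fun s => 2 * w s) psi (mf k) i2w ip (fle k).
  rewrite GE.
  have J0 s : 0 <= fourier_re psi k +
      (fourier_re psi (k + s / a) + fourier_re psi (k - s / a)) / 2.
    by rewrite addr_ge0// divr_ge0// addr_ge0.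
  have := @Rintegral_ge_itv R _ (a * `|k|) (a * `|k| + 1) (w (a * `|k| + 1) * (I / 4)) ifk.
  rewrite (_ : a * `|k| + 1 - a * `|k| = 1) ?mulr1; last by ring.
  apply.
  - by move=> s; rewrite fint mulr_ge0.
  - by rewrite lerDl.
  - move=> s /andP[s1 s2]; rewrite fint.
    have s0 : 0 <= s by rewrite (le_trans _ s1)// mulr_ge0// ltW.
    apply: ler_pM => //; first by rewrite divr_ge0// ltW.
      exact: weight_le.
    have ks : `| `|k| - s / a| <= a^-1.
      rewrite ler_norml; apply/andP; split.
        by rewrite -(ler_pM2l a0) mulrBr (mulrC a (s / a)) mulfVK ?gt_eqF// mulrN mulfV ?gt_eqF//; lra.
      rewrite -(ler_pM2l a0) mulrBr (mulrC a (s / a)) mulfVK ?gt_eqF// mulfV ?gt_eqF//; lra.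
    (* The sign of k decides whether the shift by -s/a or by +s/a lands near 0; the other terms are
       nonnegative. *)
    have [k0|k0] := leP 0 k.
      rewrite (ger0_norm k0) in ks.
      have := fourier_re_ge_half a0 ip p0 ps ks; rewrite -/I.
      by have := phat k; have := phat (k + s / a); lra.
    rewrite (ltr0_norm k0) in ks.
    have {}ks : `|k + s / a| <= a^-1 by rewrite -normrN opprD.
    have := fourier_re_ge_half a0 ip p0 ps ks; rewrite -/I.
    by have := phat k; have := phat (k - s / a); lra.
pose N := Rintegral lebesgue_measure setT G.
have N0 : 0 < N.
  by rewrite /N -fourier_re0 (lt_le_trans _ (Glow 0))// mulr_gt0 ?expR_gt0// divr_gt0.
have NW : N <= 2 * W * I.
  rewrite /I -RintegralZl//; apply: le_Rintegral => // [|x _]; last exact: GW.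
  by have := integrableZl measurableT (2 * W) ip.
exists (fun x => G x * N^-1); split.
- exact: smoothM sG (@smooth_cst R N^-1).
- by move=> x xa; rewrite Gs// mul0r.
- by move=> x; rewrite mulr_ge0// invr_ge0 ltW.
- by move=> x; rewrite Ge.
split; first by rewrite RintegralZr// mulfV// gt_eqF.
move=> k.
have -> : fourier_re (fun x => G x * N^-1) k = fourier_re G k / N.
  rewrite /fourier_re -RintegralZr//; first by apply: eq_Rintegral => x _; rewrite mulrA.
  exact: integrable_mul_le1 (measurable_cosM k) (fun x => cos_max (k * x)) iG.
rewrite ler_pdivlMr// (le_trans _ (Glow k))//.
rewrite mulrAC mulrC ler_wpM2l//.
rewrite mulrC -ler_pdivlMr ?invr_gt0 ?mulr_gt0// invrK (le_trans NW)//; lra.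
Qed.

(** Reflection about 0 changes the sign of the integrand, so its integral equals its own
    opposite. *)
Lemma fourier_im_even (R : realType) (g : R -> R) (k : R) :
  (@lebesgue_measure R).-integrable setT (EFin \o g) ->
  (forall x, g (- x) = g x) -> fourier_im g k = 0.
Proof.
move=> ig ge; rewrite /fourier_im.
have isn := integrable_mul_le1 (measurable_sinM k) (fun x => sin_max (k * x)) ig.
have [_] := integral_reflect 0 isn.
rewrite (_ : (fun x => _) = (fun x => -1 * (sin (k * x) * g x))); last first.
  by apply/funext => x; rewrite sub0r mulrN sinN ge mulN1r mulNr.
rewrite RintegralZl//; lra.
Qed.

Lemma fourier_re_ge_quad (R : realType) (g : R -> R) (a k : R) :
  (@lebesgue_measure R).-integrable setT (EFin \o g) ->
  (forall x, 0 <= g x) -> (forall x, a < `|x| -> g x = 0) ->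
  Rintegral lebesgue_measure setT g = 1 ->
  1 - (a * k) ^+ 2 / 2 <= fourier_re g k.
Proof.
move=> ig g0 gs g1.
have -> : 1 - (a * k) ^+ 2 / 2 =
    (1 - (a * k) ^+ 2 / 2) * Rintegral lebesgue_measure setT g by rewrite g1 mulr1.
rewrite -RintegralZl//.
apply: le_Rintegral => //.
- by have := integrableZl measurableT (1 - (a * k) ^+ 2 / 2) ig.
- exact: integrable_mul_le1 (measurable_cosM k) (fun x => cos_max (k * x)) ig.
- move=> x _; have [xa|xa] := ltP a `|x|; first by rewrite gs// !mulr0.
  rewrite ler_wpM2r// (le_trans _ (cos_ge_quad (k * x)))//.
  rewrite lerD2l lerN2 ler_pM2r// !exprMn mulrC ler_wpM2r ?sqr_ge0//.
  rewrite -(real_normK (num_real x)) lerXn2r ?nnegrE//.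
  exact: le_trans xa.
Qed.

(** From e^t >= 1 + t and (1 + t)(1 - t/2) = 1 + t (1 - t) / 2 >= 1 on [0, 1]. *)
Lemma expRN_le_half (R : realType) (t : R) : 0 <= t -> t <= 1 ->
  expR (- t) <= 1 - t / 2.
Proof.
move=> t0 t1; rewrite expRN.
apply: (@le_trans _ _ (1 + t)^-1).
  by rewrite lef_pV2 ?posrE ?expR_gt0 ?expR_ge1Dx//; lra.
by rewrite -[leLHS]mul1r ler_pdivrMr; nra.
Qed.

(** * Lower bound on the rate function *)

(** Beyond some K the liminf gives the bound. On [0, K] monotonicity gives eps k >= eps K, and
    replacing k by 1 + k keeps the power at least 1 down to k = 0. *)
Lemma limf_einf_powR_lower_bound (R : realType) (gamma : R) (eps : R -> R) :
  0 < gamma -> (forall x : R, 0 <= x -> 0 < eps x) ->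
  (forall x y : R, 0 <= x -> x <= y -> eps y <= eps x) ->
  (0 < limf_einf (fun k => (k `^ gamma * eps k)%:E) (pinfty_nbhs R))%E ->
  exists2 c, 0 < c & forall k, 0 <= k -> c <= (1 + k) `^ gamma * eps k.
Proof.
move=> g0 eps0 epsd; rewrite limf_einfE => /ereal_sup_gt[_ [V [M [_ HM]] <-]].
set m := ereal_inf _ => m0.
have mle k : M < k -> (m <= (k `^ gamma * eps k)%:E)%E.
  by move=> Mk; apply: ereal_inf_lbound; exists k => //; exact: HM.
pose K := `|M| + 1.
have MK : M < K by rewrite (le_lt_trans (ler_norm M))// ltrDl.
have K0 : 0 <= K by rewrite addr_ge0.
(* The infimum is positive and lies below a real value, so it is finite. *)
have [c1 c10 mE] : exists2 c1 : R, 0 < c1 & m = c1%:E.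
  move: (mle K MK) m0; case: (m) => [c1 _||] //.
  by rewrite lte_fin => c10; exists c1.
exists (Num.min c1 (eps K)); first by rewrite lt_min c10 eps0.
move=> k k0.
have k1 : 0 <= 1 + k by rewrite addr_ge0.
rewrite ge_min; have [kK|Kk] := leP k K.
  apply/orP; right; rewrite (le_trans (epsd _ _ k0 kK))//.
  rewrite ler_peMl ?(ltW (eps0 _ k0))//.
  by rewrite -[leLHS](@powRr0 R (1 + k)) ler_powR ?(ltW g0)// lerDl.
apply/orP; left; rewrite -lee_fin -mE (le_trans (mle k (lt_trans MK Kk)))//.
rewrite lee_fin ler_wpM2r ?(ltW (eps0 _ k0))//.
by apply: ge0_ler_powR; rewrite ?nnegrE ?(ltW g0) ?lerDr.
Qed.

(** * Choice of the scale and the two frequency ranges *)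

Unset Implicit Arguments.
Set Strict Implicit.

Theorem mainTheorem6 (R : realType) (l gamma : R) (eps : R -> R)
  (hl : 0 < l) (hg0 : 0 < gamma) (hg1 : gamma < 1)
  (eps_pos : forall x : R, 0 <= x -> 0 < eps x)
  (eps_decr : forall x y : R, 0 <= x -> x <= y -> eps y <= eps x)
  (eps_meas : measurable_fun (`[0%R, +oo[ : set R) eps)
  (eps_int : (\int[@lebesgue_measure R]_(k in (`[1%R, +oo[ : set R)) (eps k / k)%:E < +oo)%E)
  (eps_liminf : (0 < limf_einf (fun k => (k `^ gamma * eps k)%:E) (pinfty_nbhs R))%E) :
  exists g : R -> R,
    smooth g /\
    (forall x, `|x| > l -> g x = 0) /\
    (forall x, 0 <= g x) /\
    (forall x, g (- x) = g x) /\
    Rintegral (@lebesgue_measure R) setT g = 1 /\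
    (forall k, fourier_im g k = 0 /\
               expR (- (`|k| * eps `|k|)) <= fourier_re g k).
Proof.
have [c c0 epsc] := limf_einf_powR_lower_bound hg0 eps_pos eps_decr eps_liminf.
pose beta := 1 - gamma; have beta0 : 0 < beta by rewrite subr_gt0.
have b0 : 0 < beta / 2 by rewrite divr_gt0.
have [A A0 HA] := modulated_bump b0.
(* For tau = a |k| >= 1, A times the weight at tau + 1 is at least exp (- M tau^beta): [|ln A|]
   absorbs A, and 5 comes from 1 + (tau + 1)^2 <= 5 tau^2. *)
pose M := `|ln A| + 5 `^ (beta / 2).
have M0 : 0 <= M by rewrite addr_ge0 ?powR_ge0.
(* The 2 comes from 1 + q <= 2 q for q >= 1 in the high range, and from a (1 + q) <= 2 in the low
   range. *)
pose D := c / 2 `^ gamma.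
have D0 : 0 < D by rewrite divr_gt0 ?powR_gt0.
(* The bound by l fits the support and the last term gives a^beta (1 + M) <= D, whose summand M
   serves the range tau >= 1 and whose summand 1 serves tau < 1. *)
pose a := Num.min (Num.min 1 l) ((D / (1 + M)) `^ beta^-1).
have DM0 : 0 < D / (1 + M) by rewrite divr_gt0//; lra.
have a0 : 0 < a by rewrite !lt_min ltr01 hl powR_gt0.
have a1 : a <= 1 by rewrite !ge_min lexx.
have al : a <= l by rewrite !ge_min lexx orbT.
have aD : a `^ beta * (1 + M) <= D.
  rewrite -ler_pdivlMr; last by lra.
  have -> : D / (1 + M) = ((D / (1 + M)) `^ beta^-1) `^ beta.
    by rewrite -powRrM mulVf ?gt_eqF// powRr1// ltW.
  apply: ge0_ler_powR; rewrite ?nnegrE ?powR_ge0 ?(ltW beta0) ?(ltW a0)//.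
  by rewrite ge_min lexx orbT.
have ab0 : 0 < a `^ beta by rewrite powR_gt0.
have [g [sg gs g0 ge [g1 gA]]] := HA a a0.
have cg := smooth_continuous sg.
have ig : (@lebesgue_measure R).-integrable setT (EFin \o g).
  have [N HN] := continuous_bounded_support cg gs.
  by apply: integrable_bounded_support HN gs; exact: continuous_measurable_fun.
exists g; split=> //; split; first by move=> x lx; apply: gs; exact: le_lt_trans lx.
split=> //; split=> //; split=> // k; split; first exact: fourier_im_even.
have := fourier_re_ge_quad k ig g0 gs g1; have := gA k.
have -> : (a * k) ^+ 2 = (a * `|k|) ^+ 2.
  by rewrite !exprMn real_normK ?num_real.
move: `|k| (normr_ge0 k) => q q0 HgA Hquad.
have e0 := eps_pos q q0; have ce := epsc q q0.
pose tau := a * q; have tau0 : 0 <= tau by rewrite mulr_ge0// ltW.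
have gammaDbeta (x : R) : 0 < x -> x `^ beta * x `^ gamma = x.
  move=> x0; rewrite -powRD; last by rewrite subrK oner_eq0.
  by rewrite subrK powRr1// ltW.
(* High range: M tau^beta = M a^beta q^beta <= D q^beta <= q eps(q). *)
have [tau1|tau1] := leP 1 tau.
- apply: le_trans HgA; rewrite -/tau /weight.
  have q1 : 1 <= q by rewrite (le_trans tau1)// /tau ler_piMl.
  have qb : tau `^ beta = a `^ beta * q `^ beta by rewrite powRM// ltW.
  have qe : D * q `^ beta <= q * eps q.
    rewrite -[X in _ <= X * _]gammaDbeta ?(lt_le_trans ltr01)// mulrC -mulrA.
    rewrite ler_wpM2l ?powR_ge0// ler_pdivrMr ?powR_gt0//.
    rewrite (le_trans ce)// mulrAC ler_wpM2r ?(ltW e0)//.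
    rewrite -powRM//; apply: ge0_ler_powR; rewrite ?nnegrE ?(ltW hg0)//; lra.
  have tb1 : 1 <= tau `^ beta.
    by rewrite -[leLHS](@powRr0 R tau) ler_powR// ltW.
  have tb : (oneDsqr (tau + 1)) `^ (beta / 2) <= 5 `^ (beta / 2) * tau `^ beta.
    have -> : tau `^ beta = (tau ^+ 2) `^ (beta / 2).
      by rewrite -powR_mulrn// -powRrM; congr (_ `^ _); lra.
    rewrite -powRM ?sqr_ge0//; apply: ge0_ler_powR.
    + exact: ltW.
    + by rewrite nnegrE (le_trans ler01)// oneDsqr_ge1.
    + by rewrite nnegrE mulr_ge0// sqr_ge0.
    + by rewrite /oneDsqr; nra.
  have AE : A = expR (ln A) by rewrite lnK ?posrE.
  rewrite AE -expRD ler_expR.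
  have lnA := ler_norm (- ln A); rewrite normrN in lnA.
  have MD : M * tau `^ beta <= D * q `^ beta.
    rewrite qb mulrA ler_wpM2r ?powR_ge0// mulrC; apply: le_trans aD.
    by rewrite ler_wpM2l ?(ltW ab0)// lerDr.
  have : `|ln A| <= `|ln A| * tau `^ beta by rewrite ler_peMr.
  move: MD; rewrite /M mulrDl; move: tb lnA qe; lra.
(* Low range: 1 - tau^2 / 2 >= exp (- tau^2), so tau^2 <= q eps(q) suffices. Indeed tau^2 <= tau =
   a^beta a^gamma q <= D a^gamma q <= q eps(q). *)
- apply: le_trans Hquad; rewrite -/tau.
  have t1 : tau ^+ 2 <= 1 by rewrite expr2; nra.
  apply: le_trans (expRN_le_half (sqr_ge0 tau) t1).
  rewrite ler_expR lerN2.
  have aq2 : a * (1 + q) <= 2 by rewrite mulrDr mulr1; rewrite /tau in tau1; lra.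
  have De : D * a `^ gamma <= eps q.
    rewrite mulrAC ler_pdivrMr ?powR_gt0// [leRHS]mulrC.
    have ag : a `^ gamma * (1 + q) `^ gamma <= 2 `^ gamma.
      rewrite -powRM ?(ltW a0)//; last by lra.
      apply: ge0_ler_powR; rewrite ?nnegrE ?(ltW hg0)//.
      by rewrite mulr_ge0// ?(ltW a0)//; lra.
    apply: le_trans (ler_wpM2r (ltW e0) ag).
    by rewrite mulrC -mulrA ler_wpM2l ?powR_ge0.
  have ab : a `^ beta <= D.
    by apply: le_trans aD; rewrite ler_peMr ?(ltW ab0)// lerDl.
  apply: (@le_trans _ _ tau); first by rewrite expr2; nra.
  rewrite /tau mulrC ler_wpM2l// -[leLHS]gammaDbeta//.
  by apply: le_trans De; rewrite ler_wpM2r ?powR_ge0.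
Qed.
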